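(* Let $p$ and $\wp$ be odd primes and $m$ a positive integer such that $p$ is a primitive root modulo $2\wp^m$. Let $q=p^{\phi(2\wp^m)}$, let $g$ be a primitive element of $\mathbb{F}_q$, and let $\xi=g^{\frac{q-1}{2\wp^m}}$. For any $a\in\mathbb{F}_q$, write $a=a_1\xi+a_2\xi^2+\cdots+a_{\phi(\wp^m)}\xi^{\phi(\wp^m)}$ with each $a_s\in\mathbb{F}_p$. Then $$S_{2\wp^m}(a)=\sum_{i=0}^{\wp^{m-1}-1}\left(\zeta_p^{\Delta_i}+\zeta_p^{-\Delta_i}+\sum_{t=1}^{\wp-1}\left(\delta_{i,t}+\delta_{i,t}^{-1}\right)\right),$$ where $$\Delta_i=-\wp^{m-1}\sum_{k=1}^{\wp-1}(-1)^ka_{k\wp^{m-1}-i}\quad\text{and}\quad \delta_{i,t}=\zeta_p^{(-1)^t\Delta_i+\wp^ma_{t\wp^{m-1}-i}}.$$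
   Context: $\phi$ is Euler's totient function; note $\phi(2\wp^m)=\phi(\wp^m)=(\wp-1)\wp^{m-1}$. $\zeta_p=e^{2\pi i/p}$; for $u\in\mathbb{F}_p$, $\zeta_p^{u}$ is defined via any integer representative of $u$. ${\rm Tr}$ is the absolute trace $\mathbb{F}_q\to\mathbb{F}_p$, and $\chi(x)=e^{2\pi i{\rm Tr}(x)/p}$ is the canonical additive character of $\mathbb{F}_q$. For $a\in\mathbb{F}_q$, $S_{2\wp^m}(a):=\sum_{j=0}^{2\wp^m-1}\chi(a\xi^j)$. A primitive element of $\mathbb{F}_q$ is a generator of $\mathbb{F}_q^*$. The set $\{\xi,\xi^2,\ldots,\xi^{\phi(\wp^m)}\}$ is a basis of $\mathbb{F}_q$ over $\mathbb{F}_p$, so the coefficients $a_s$ are uniquely determined. *)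

(* Defs.v *)
From HB Require Import structures.
From mathcomp Require Import all_boot all_order all_algebra all_fingroup.
From mathcomp Require Import all_solvable all_field.
From mathcomp Require Import complex.
From mathcomp Require Import reals trigo.

Set Implicit Arguments.
Unset Strict Implicit.
Unset Printing Implicit Defensive.

Import Order.TTheory GRing.Theory Num.Theory.

Local Open Scope ring_scope.
Local Open Scope complex_scope.

(* The order of b modulo n is phi(n).  As 'Z_n is Z/nZ only for n >= 2, this
   is meaningful only for 1 < n. *)
Definition primitive_root_mod (n b : nat) : bool :=
  (totient n).-primitive_root (b%:R : 'Z_n).

(* The embedding of the prime field into F; meaningful when F has
   characteristic p. *)
Definition Fp_in (F : finFieldType) (p : nat) (u : 'F_p) : F :=
  (u : nat)%:R.

(* x + x^p + ... + x^(p^(n-1)), where #|F| = p^n, as an element of F. *)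
Definition frob_sum (F : finFieldType) (p : nat) (x : F) : F :=
  \sum_(i < logn p #|F|) x ^+ (p ^ i).

(* The preimage in 'F_p of frob_sum; the default 0 is never used when #|F| is
   a power of p, see abs_trP. *)
Definition abs_tr (F : finFieldType) (p : nat) (x : F) : 'F_p :=
  odflt 0 [pick u : 'F_p | Fp_in F u == frob_sum p x].

(* exp (i t) for real t *)
Definition expi (R : realType) (t : R) : R[i] := cos t +i* sin t.

Definition zeta (R : realType) (p : nat) : R[i] := expi (2 * pi / p%:R).

(* zeta_p ^ u, by the representative of u in {0, ..., p - 1}; see zeta_powP
   for the other nonnegative ones, and zeta_powN for the sign. *)
Definition zeta_pow (R : realType) (p : nat) (u : 'F_p) : R[i] :=
  zeta R p ^+ (u : nat).

Definition canon_char (R : realType) (F : finFieldType) (p : nat) (x : F) :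
  R[i] := expi (2 * pi * (abs_tr p x : nat)%:R / p%:R).

Definition char_sum (R : realType) (F : finFieldType) (p : nat) (xi : F)
  (N : nat) (a : F) : R[i] := \sum_(j < N) canon_char R p (a * xi ^+ j).

Section Checks.

Variables (R : realType) (F : finFieldType) (p n : nat).
Hypotheses (p_pr : prime p) (cardF : #|F| = (p ^ n)%N).

Let pcharF : p \in [pchar F] := card_finPcharP cardF p_pr.

Lemma Fp_in_inj : injective (@Fp_in F p).
Proof.
have ltp (u : 'F_p) : (u < p)%N by have := ltn_ord u; rewrite [in X in (_ < X)%N -> _]Fp_cast.
move=> u v; rewrite /Fp_in => e; apply: val_inj => /=.
wlog uv : u v e / (u <= v)%N.
  by move=> h; case/orP: (leq_total u v) => /h -> //.
have : ((v - u)%:R : F) == 0 by rewrite natrB // e subrr.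
rewrite -(dvdn_pcharf pcharF) => d.
have [/eqP|gt0] := posnP (v - u).
  by rewrite subn_eq0 => vu; apply/eqP; rewrite eqn_leq uv.
by have := dvdn_leq gt0 d; rewrite leqNgt (leq_ltn_trans (leq_subr _ _) (ltp v)).
Qed.

Lemma abs_trP (x : F) : Fp_in F (abs_tr p x) = frob_sum p x.
Proof.
rewrite /abs_tr; case: pickP => [u /eqP //|no].
set y := frob_sum p x in no *.
have yp : y ^+ p = y.
  rewrite /y /frob_sum cardF pfactorK // -(pFrobenius_autE pcharF) rmorph_sum /=.
  under eq_bigr => i _ do rewrite pFrobenius_autE -exprM -expnSr.
  case: n cardF => [|k] ck; first by rewrite !big_ord0.
  rewrite big_ord_recr big_ord_recl /= -ck expf_card expn0 expr1 addrC.
  by congr (_ + _).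
have ps : size ('X^p - 'X : {poly F}) = p.+1.
  by rewrite size_polyDl ?size_polyXn // size_polyN size_polyX ltnS prime_gt1.
have pn0 : ('X^p - 'X : {poly F}) != 0 by rewrite -size_poly_eq0 ps.
pose rs := y :: [seq Fp_in F u | u <- enum 'F_p].
have rs_root : all (root ('X^p - 'X)) rs.
  apply/andP; split; first by rewrite /root !hornerE yp subrr.
  apply/allP => z /mapP[u _ ->]; rewrite /root !hornerE.
  by rewrite /Fp_in -(pFrobenius_autE pcharF) rmorph_nat subrr.
have rs_uniq : uniq rs.
  rewrite /= (map_inj_uniq Fp_in_inj) enum_uniq andbT.
  by apply/mapP => -[u _ e]; have := no u; rewrite e eqxx.
have := max_poly_roots pn0 rs_root rs_uniq.
by rewrite /= size_map -cardE card_Fp // ps ltnn.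
Qed.

Lemma expiX (t : R) k : expi t ^+ k = expi (t *+ k).
Proof.
elim: k => [|k IH]; first by rewrite /expi expr0 mulr0n cos0 sin0.
rewrite exprS IH mulrS /expi cosD sinD.
by apply/eqP; rewrite eq_complex /= eqxx /= addrC eqxx.
Qed.

Lemma zetaXp : zeta R p ^+ p = 1.
Proof.
rewrite /zeta expiX -[_ *+ p]mulr_natr divfK; last first.
  by rewrite pnatr_eq0 -lt0n prime_gt0.
by rewrite mulr_natl /expi cos2pi sin2pi.
Qed.

Lemma zeta_powP (k : nat) : zeta_pow R (k%:R : 'F_p) = zeta R p ^+ k.
Proof.
rewrite /zeta_pow val_Fp_nat // [in RHS](divn_eq k p) exprD mulnC exprM.
by rewrite zetaXp expr1n mul1r.
Qed.

Lemma zeta_powN (u : 'F_p) : zeta_pow R (- u) = (zeta_pow R u)^-1.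
Proof.
have uv : zeta_pow R (- u) * zeta_pow R u = 1.
  rewrite -[LHS]exprD -zeta_powP natrD !natr_Zp addNr.
  by rewrite /zeta_pow expr0.
have nz : zeta_pow R u != 0.
  by apply: contra_eq_neq uv => ->; rewrite mulr0 eq_sym oner_eq0.
by apply: (mulIf nz); rewrite uv mulVf.
Qed.

Lemma canon_charE (x : F) : canon_char R p x = zeta_pow R (abs_tr p x).
Proof. by rewrite /zeta_pow /zeta expiX -[_ *+ _ in RHS]mulr_natr mulrAC. Qed.

End Checks.

(* Main.v *)
From HB Require Import structures.
Require Import Defs.
From mathcomp Require Import all_boot all_order all_algebra all_fingroup.
From mathcomp Require Import all_solvable all_field.
From mathcomp Require Import complex.
From mathcomp Require Import reals trigo.
From mathcomp Require Import zify ring.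

Set Implicit Arguments.
Unset Strict Implicit.
Unset Printing Implicit Defensive.

Import GRing.Theory.
Local Open Scope ring_scope.

(** The theorem amounts to computing the absolute trace of every a xi^j.

    Put n = l^m and L = l^(m-1).  As p generates the units modulo 2n, it also
    generates those modulo n, so the conjugates of the primitive n-th root of
    unity w = - xi are all the w^u with u prime to n.  The trace of w^k is
    therefore the Ramanujan sum of these w^(k u), which is
    n [n | k] - L [L | k]: subtract from the sum over all u modulo n the sum
    over the multiples of l.  This gives [frob_sum_root], the trace of
    xi^k = (-1)^k w^k, and by linearity [abs_tr_root_combination].

    Write an exponent j < n as j = r L + i with i < L and r < l.  In the trace
    of a xi^j, a basis exponent s contributes only if L divides s + j, that
    is, if s = k L - i with 1 <= k <= l - 1; then s + j = (k + r) L, which is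
    a multiple of n only for k = l - r ([trace_at_blocks]).  Hence the trace
    is Delta_i for r = 0, and for r = l - t it is minus the exponent of
    delta_(i,t) ([trace_at_first], [trace_at_rest]).  Finally xi^n = -1, so
    the second half of the character sum consists of the inverses of the terms
    of the first half, which produces the symmetric form of the answer. *)

(** * Ramanujan sums for a prime power modulus *)

Lemma sum_nat_blocks (V : nmodType) (n b : nat) (f : nat -> V) :
  \sum_(0 <= s < n * b) f s =
    \sum_(0 <= k < n) \sum_(0 <= i < b) f (k * b + i)%N.
Proof.
rewrite big_nat_mul; apply: eq_bigr => k _.
rewrite -[X in \sum_(X <= _ < _) _]add0n big_addn mulSn addnK.
by apply: eq_bigr => i _; rewrite addnC.
Qed.

Lemma sum_residue_class (V : nmodType) (n b r : nat) (f : nat -> V) :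
    (r < b)%N ->
  \sum_(0 <= s < n * b | (s %% b)%N == r) f s =
    \sum_(0 <= k < n) f (k * b + r)%N.
Proof.
move=> r_lt_b; rewrite big_mkcond sum_nat_blocks; apply: eq_bigr => k _.
rewrite big_mkord (bigD1 (Ordinal r_lt_b)) //= modnMDl modn_small // eqxx.
rewrite big1 ?addr0 // => i i_neq_r.
by rewrite modnMDl modn_small // ifN.
Qed.

Lemma sum_prim_root (F : fieldType) (n : nat) (w : F) (k : nat) :
  n.-primitive_root w -> \sum_(0 <= i < n) w ^+ (k * i) = n%:R *+ (n %| k).
Proof.
move=> w_prim; rewrite big_mkord; under eq_bigr => i _ do rewrite exprM.
have [n_dvd_k|n_ndvd_k] := boolP (n %| k)%N.
  have /eqP -> : w ^+ k == 1 by rewrite -(prim_order_dvd w_prim).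
  under eq_bigr => i _ do rewrite expr1n.
  by rewrite sumr_const card_ord.
have wk_neq1 : w ^+ k - 1 != 0 by rewrite subr_eq0 -(prim_order_dvd w_prim).
apply: (mulfI wk_neq1).
by rewrite -subrX1 exprAC (prim_expr_order w_prim) expr1n subrr mulr0.
Qed.

(** The indices u that are not prime to l^m are the multiples u = l v with
    v < l^(m-1), and w^l is a primitive root of unity of order l^(m-1): both
    the full sum and the sum over these indices are geometric. *)
Lemma ramanujan_sum_prime_power (F : fieldType) (l m : nat) (w : F) (k : nat) :
    prime l -> (0 < m)%N -> (l ^ m).-primitive_root w ->
  \sum_(0 <= u < l ^ m | coprime u (l ^ m)) w ^+ (k * u) =
    (l ^ m)%:R *+ (l ^ m %| k) - (l ^ m.-1)%:R *+ (l ^ m.-1 %| k).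
Proof.
case: m => // m l_prime _ w_prim /=.
have l_gt0 := prime_gt0 l_prime.
have wl_prim : (l ^ m).-primitive_root (w ^+ l).
  have := dvdn_prim_root w_prim (dvdn_exp2l l (leqnSn m)).
  by rewrite expnS mulnK // expn_gt0 l_gt0.
rewrite -(sum_prim_root _ w_prim) -(sum_prim_root _ wl_prim).
apply/eqP; rewrite eq_sym subr_eq; apply/eqP.
rewrite (bigID (fun u => coprime u (l ^ m.+1))) /=; congr (_ + _).
rewrite (eq_bigl (fun u => (u %% l)%N == 0)) => [|u]; last first.
  by rewrite coprime_pexpr // coprime_sym prime_coprime // negbK.
rewrite [in LHS]expnSr sum_residue_class //; apply: eq_bigr => u _.
by rewrite addn0 -exprM; congr (_ ^+ _); ring.
Qed.

(** * Powers of a primitive root *)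

Lemma primitive_root_mod_eq (n p i j : nat) :
    (1 < n)%N -> primitive_root_mod n p ->
  (p ^ i == p ^ j %[mod n])%N = (i == j %[mod totient n])%N.
Proof.
move=> n_gt1 p_prim; rewrite -(eq_prim_root_expr p_prim) -!natrX.
by rewrite -val_eqE /= !val_Zp_nat.
Qed.

(** As n is odd, the reduction from units modulo 2n to units modulo n is
    bijective; it is injective on powers of p because these are all odd, and
    the two unit groups have the same order. *)
Lemma sum_powers_primitive_root (V : nmodType) (n p : nat) (f : nat -> V) :
    odd n -> (1 < n)%N -> odd p -> primitive_root_mod (2 * n) p ->
  \sum_(i < totient (2 * n)) f (p ^ i %% n)%N =
    \sum_(0 <= u < n | coprime u n) f u.
Proof.
move=> n_odd n_gt1 p_odd p_prim; have n_gt0 := ltnW n_gt1.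
have n2_gt1 : (1 < 2 * n)%N by lia.
have totE : totient (2 * n) = totient n.
  by rewrite totient_coprime ?mul1n // coprime2n.
have tot_gt0 : (0 < totient (2 * n))%N by rewrite totient_gt0; lia.
pose h (i : 'I_(totient (2 * n))) := Ordinal (ltn_pmod (p ^ i) n_gt0).
have h_inj : injective h.
  move=> i j /(congr1 val) /= /eqP hij; apply/val_inj/eqP.
  have : (p ^ i == p ^ j %[mod 2 * n])%N.
    rewrite chinese_remainder ?coprime2n // hij andbT !modn2 !oddX p_odd.
    by rewrite !orbT.
  by rewrite primitive_root_mod_eq // !modn_small.
have p_cop : coprime p n.
  have : (p ^ totient (2 * n) == p ^ 0 %[mod n])%N.
    have : (p ^ totient (2 * n) == p ^ 0 %[mod 2 * n])%N.
      by rewrite primitive_root_mod_eq // modnn mod0n.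
    by rewrite chinese_remainder ?coprime2n // => /andP[].
  rewrite expn0 => /eqP pt1.
  by rewrite -(coprime_pexpl _ _ tot_gt0) -coprime_modl pt1
    coprime_modl coprime1n.
have him : [set h i | i in 'I_(totient (2 * n))] = [set u : 'I_n | coprime u n].
  apply/eqP; rewrite eqEcard; apply/andP; split.
    apply/subsetP => _ /imsetP[i _ ->].
    by rewrite inE /= coprime_modl coprimeXl.
  rewrite card_imset // card_ord totE totient_count_coprime big_mkord.
  rewrite -sum1dep_card big_mkcond /=; apply: leq_sum => u _.
  by rewrite coprime_sym; case: coprime.
rewrite big_mkord (eq_bigl (fun u => u \in [set u : 'I_n | coprime u n]));
  last by move=> u; rewrite inE.
by rewrite -him big_imset //= => i j _ _; apply: h_inj.
Qed.

(** * Roots of unity in a finite field *)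

(** The group order of g, a statement about the finite group of units, is
    transferred here to the ring-theoretic notion of order. *)
Lemma generator_prim_root (F : finFieldType) (g : {unit F}) :
  generator [set: {unit F}] g -> (#|F|.-1).-primitive_root (FinRing.uval g).
Proof.
move=> /eqP g_gen; have order_g : #[g]%g = #|F|.-1.
  by rewrite orderE -g_gen card_finField_unit.
have gX k : (FinRing.uval g ^+ k == 1) = (#|F|.-1 %| k)%N.
  rewrite -(FinRing.val_unitX k g) -FinRing.val_unit1 val_eqE.
  by rewrite -order_dvdn order_g.
have q_gt0 : (0 < #|F|.-1)%N by rewrite -order_g order_gt0.
have /eqP gq : FinRing.uval g ^+ #|F|.-1 == 1 by rewrite gX.
have [k k_prim k_dvd] := prim_order_exists q_gt0 gq.
suff -> : #|F|.-1 = k by [].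
apply/eqP; rewrite eqn_dvd k_dvd andbT -gX.
by rewrite (prim_expr_order k_prim).
Qed.

Lemma prim_root_double_half (F : fieldType) (n : nat) (x : F) :
  (0 < n)%N -> (2 * n).-primitive_root x -> x ^+ n = -1.
Proof.
move=> n_gt0 x_prim; have : x ^+ n ^+ 2 == 1.
  by rewrite -exprM mulnC (prim_expr_order x_prim).
rewrite sqrf_eq1 -(prim_order_dvd x_prim) => /orP[/(dvdn_leq n_gt0)|/eqP //].
lia.
Qed.

(** - x = x^(n+1), whose order is 2n / gcd (n+1, 2n) = n. *)
Lemma prim_root_double_opp (F : fieldType) (n : nat) (x : F) :
  odd n -> (2 * n).-primitive_root x -> n.-primitive_root (- x).
Proof.
move=> n_odd x_prim; have n_gt0 := odd_gt0 n_odd.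
have -> : - x = x ^+ n.+1.
  by rewrite exprS (prim_root_double_half n_gt0 x_prim) mulrN1.
have n1E : n.+1 = (2 * n.+1./2)%N by lia.
have half_cop : coprime n.+1./2 n.
  by have := coprimeSn n; rewrite {1}n1E coprimeMl => /andP[].
have := exp_prim_root x_prim n.+1.
by rewrite {1}n1E -muln_gcdr (eqP half_cop) muln1 mulKn.
Qed.

(** * The absolute trace *)

Section Trace.

Variables (F : finFieldType) (p : nat).
Hypothesis pcharF : p \in [pchar F].

(** [Fp_in] is a ring morphism only in characteristic p; carrying the proof of
    this as a parameter is what allows the morphism structure to be
    attached to it. *)
Definition prime_embedding of p \in [pchar F] : 'F_p -> F := @Fp_in F p.
Local Notation phi := (prime_embedding pcharF).

Lemma prime_embedding_nat (k : nat) : phi k%:R = k%:R.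
Proof.
have p_prime := pcharf_prime pcharF.
rewrite /prime_embedding /Fp_in val_Fp_nat // [in RHS](divn_eq k p).
by rewrite natrD natrM (pcharf0 pcharF) mulr0 add0r.
Qed.

Lemma prime_embedding_zmod : zmod_morphism phi.
Proof.
have phiD : {morph phi : u v / u + v}.
  move=> u v; rewrite -(natr_Zp u) -(natr_Zp v) -natrD.
  by rewrite !prime_embedding_nat natrD.
by move=> u v; apply: (addIr (phi v)); rewrite -phiD !subrK.
Qed.

Lemma prime_embedding_monoid : monoid_morphism phi.
Proof.
split=> [|u v]; first exact: (prime_embedding_nat 1).
by rewrite -(natr_Zp u) -(natr_Zp v) -natrM !prime_embedding_nat natrM.
Qed.

HB.instance Definition _ :=
  GRing.isZmodMorphism.Build 'F_p F phi prime_embedding_zmod.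
HB.instance Definition _ :=
  GRing.isMonoidMorphism.Build 'F_p F phi prime_embedding_monoid.

Lemma prime_embedding_fixed (u : 'F_p) (i : nat) : phi u ^+ (p ^ i) = phi u.
Proof.
elim: i => [|i IH]; first by rewrite expn0.
rewrite expnSr exprM IH -(pFrobenius_autE pcharF).
by rewrite /prime_embedding /Fp_in rmorph_nat.
Qed.

Lemma frob_sum_linear (r : seq nat) (c : nat -> 'F_p) (x : nat -> F) :
  frob_sum p (\sum_(s <- r) phi (c s) * x s) =
    \sum_(s <- r) phi (c s) * frob_sum p (x s).
Proof.
under [RHS]eq_bigr => s _ do rewrite /frob_sum mulr_sumr.
rewrite exchange_big; apply: eq_bigr => i _ /=.
elim: {i}(i : nat) => [|i IH]; first by rewrite expn0.
rewrite expnSr exprM IH -(pFrobenius_autE pcharF) rmorph_sum.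
apply: eq_bigr => s _; rewrite rmorphM /= !pFrobenius_autE -exprM -expnSr.
by congr (_ * _); exact: (prime_embedding_fixed _ 1).
Qed.

End Trace.

(** The trace of xi^k for xi a primitive root of unity of order 2 l^m
    ([frob_sum_root]): up to the sign of xi^k = (-1)^k (- xi)^k, the Ramanujan
    sum modulo l^m. *)
Definition root_trace (p l m k : nat) : 'F_p :=
  (-1) ^+ k * ((l ^ m)%:R *+ (l ^ m %| k) - (l ^ m.-1)%:R *+ (l ^ m.-1 %| k)).

(** The conjugates (- xi)^(p^i) of - xi are all the primitive roots of unity of
    order l^m; the factor (-1)^k of xi^k is not affected by Frobenius. *)
Lemma frob_sum_root (F : finFieldType) (p l m : nat) (xi : F) (k : nat)
    (pcharF : p \in [pchar F]) :
    odd p -> prime l -> odd l -> (0 < m)%N ->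
    primitive_root_mod (2 * l ^ m) p ->
    #|F| = (p ^ totient (2 * l ^ m))%N ->
    (2 * l ^ m).-primitive_root xi ->
  frob_sum p (xi ^+ k) = prime_embedding pcharF (root_trace p l m k).
Proof.
move=> p_odd l_prime l_odd m_gt0 p_prim cardF xi_prim.
have n_odd : odd (l ^ m) by rewrite oddX l_odd orbT.
have n_gt1 : (1 < l ^ m)%N by rewrite -(exp1n m) ltn_exp2r // prime_gt1.
have w_prim := prim_root_double_opp n_odd xi_prim.
have p_prime := pcharf_prime pcharF.
rewrite /root_trace rmorphM rmorphXn rmorphN1 rmorphB !rmorphMn /= rmorph1.
rewrite -(ramanujan_sum_prime_power k l_prime m_gt0 w_prim).
rewrite -(sum_powers_primitive_root _ n_odd n_gt1 p_odd p_prim) mulr_sumr.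
rewrite /frob_sum cardF pfactorK //; apply: eq_bigr => i _.
have -> : (- xi) ^+ (k * (p ^ i %% l ^ m)) = (- xi) ^+ (k * p ^ i).
  apply/eqP; rewrite (eq_prim_root_expr w_prim).
  by rewrite -modnMmr modn_mod modnMmr.
rewrite -exprM (exprNn xi) mulrA -exprD.
have -> : (-1) ^+ (k + k * p ^ i) = 1 :> F.
  by rewrite -signr_odd oddD oddM oddX p_odd orbT andbT addbb.
by rewrite mul1r.
Qed.

(** Linearity of the trace over the prime field; the equality is checked after
    embedding the prime field in F. *)
Lemma abs_tr_root_combination (F : finFieldType) (p l m : nat) (xi : F)
    (c : nat -> 'F_p) (r : seq nat) (j : nat) :
    prime p -> odd p -> prime l -> odd l -> (0 < m)%N ->
    primitive_root_mod (2 * l ^ m) p ->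
    #|F| = (p ^ totient (2 * l ^ m))%N ->
    (2 * l ^ m).-primitive_root xi ->
  abs_tr p ((\sum_(s <- r) Fp_in F (c s) * xi ^+ s) * xi ^+ j) =
    \sum_(s <- r) c s * root_trace p l m (s + j).
Proof.
move=> p_prime p_odd l_prime l_odd m_gt0 p_prim cardF xi_prim.
have pcharF := card_finPcharP cardF p_prime.
apply: (Fp_in_inj p_prime cardF); rewrite (abs_trP p_prime cardF).
rewrite -/(prime_embedding pcharF _) rmorph_sum mulr_suml.
under eq_bigr => s _ do rewrite -mulrA -exprD -/(prime_embedding pcharF _).
rewrite frob_sum_linear; apply: eq_bigr => s _.
by rewrite rmorphM /= (frob_sum_root _ pcharF p_odd l_prime l_odd m_gt0).
Qed.

(** * The trace of a xi^j in terms of the coefficients of a *)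

Section Evaluation.

Variables (p l m : nat) (c : nat -> 'F_p).
Hypotheses (l_prime : prime l) (l_odd : odd l) (m_gt0 : (0 < m)%N).

Let Delta (i : nat) : 'F_p :=
  - ((l ^ m.-1)%:R * \sum_(1 <= k < l) (-1) ^+ k * c (k * l ^ m.-1 - i)%N).

(** This is the trace of a xi^j when c lists the coefficients of a, by
    [abs_tr_root_combination]. *)
Let trace_at (j : nat) : 'F_p :=
  \sum_(1 <= s < (totient (l ^ m)).+1) c s * root_trace p l m (s + j).

Lemma root_traceM (k : nat) :
  root_trace p l m (k * l ^ m.-1) =
    (-1) ^+ k * ((l ^ m)%:R *+ (l %| k) - (l ^ m.-1)%:R).
Proof.
have L_gt0 : (0 < l ^ m.-1)%N by rewrite expn_gt0 prime_gt0.
have sign : (-1) ^+ (k * l ^ m.-1) = (-1) ^+ k :> 'F_p.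
  by rewrite -signr_odd oddM oddX l_odd orbT andbT signr_odd.
have dvdE : (l ^ m %| k * l ^ m.-1)%N = (l %| k)%N.
  by rewrite -[in (l ^ m)%N](prednK m_gt0) expnS dvdn_pmul2r.
by rewrite /root_trace sign dvdE dvdn_mull.
Qed.

(** Every trace [root_trace] vanishes off the multiples of L = l^(m-1), so only
    s = k L - i survives, and then s + (r L + i) = (k + r) L. *)
Lemma trace_at_blocks (i r : nat) : (i < l ^ m.-1)%N ->
  trace_at (r * l ^ m.-1 + i) =
    \sum_(1 <= k < l) c (k * l ^ m.-1 - i)%N *
      ((-1) ^+ (k + r) * ((l ^ m)%:R *+ (l %| k + r) - (l ^ m.-1)%:R)).
Proof.
set L := (l ^ m.-1)%N => i_lt; have L_gt0 : (0 < L)%N by lia.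
have nE : (l ^ m = l * L)%N by rewrite /L -expnS prednK.
rewrite /trace_at totient_pfactor // big_add1 /= -/L.
(* The index is shifted by one, so s stands for the exponent s + 1; L divides
   s + 1 + i exactly when s = L - 1 - i modulo L. *)
rewrite (bigID (fun s => (s %% L)%N == (L - i.+1)%N)) /=.
rewrite [X in _ + X]big1 ?addr0 => [|s s_mod]; last first.
  have L_ndvd : ~~ (L %| s.+1 + (r * L + i))%N.
    apply: contraNN s_mod => /dvdnP[d dE].
    have -> : s = ((d - r.+1) * L + (L - i.+1))%N.
      have r_lt_d : (r < d)%N by rewrite -(ltn_pmul2r L_gt0); lia.
      have := leq_mul r_lt_d (leqnn L).
      by rewrite mulnBl mulSn; lia.
    by rewrite modnMDl modn_small //; lia.
  have n_ndvd : ~~ (l ^ m %| s.+1 + (r * L + i))%N.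
    by apply: contraNN L_ndvd => /(dvdn_trans _) -> //; rewrite nE dvdn_mull.
  by rewrite /root_trace -/L (negPf L_ndvd) (negPf n_ndvd) subrr !mulr0.
rewrite sum_residue_class ?[in RHS]big_add1; last by lia.
apply: eq_big_nat => k _.
have -> : (k * L + (L - i.+1)).+1 = (k.+1 * L - i)%N by rewrite mulSn; lia.
rewrite -root_traceM -/L; congr (_ * root_trace _ _ _ _).
by rewrite mulnDl mulSn; lia.
Qed.

(** For r = 0 no k in the range is a multiple of l, so the Ramanujan sums are
    all equal to - l^(m-1). *)
Lemma trace_at_first (i : nat) : (i < l ^ m.-1)%N -> trace_at i = Delta i.
Proof.
move=> i_lt; rewrite -[i in LHS]add0n -(mul0n (l ^ m.-1)%N) trace_at_blocks //.
rewrite /Delta -mulrN -sumrN mulr_sumr.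
apply: eq_big_nat => k /andP[k_gt0 k_lt]; rewrite addn0 gtnNdvd //= sub0r.
ring.
Qed.

(** For r = l - t the only multiple of l among the k + r is at k = t, and
    (-1)^(k + r) = - (-1)^t (-1)^k as l is odd. *)
Lemma trace_at_rest (i t : nat) : (i < l ^ m.-1)%N -> (0 < t < l)%N ->
  trace_at ((l - t) * l ^ m.-1 + i) =
    - ((-1) ^+ t * Delta i + (l ^ m)%:R * c (t * l ^ m.-1 - i)%N).
Proof.
move=> i_lt /andP[t_gt0 t_lt]; rewrite trace_at_blocks //.
have sign k : (-1) ^+ (k + (l - t)) = - ((-1) ^+ t * (-1) ^+ k) :> 'F_p.
  rewrite -[RHS]mulN1r -exprD -exprS -signr_odd -[RHS]signr_odd.
  by congr (_ ^+ nat_of_bool _); lia.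
have lkt k : (1 <= k < l)%N -> (l %| k + (l - t))%N = (k == t).
  move=> /andP[k_gt0 k_lt]; apply/idP/eqP => [/dvdnP[d dE]|->]; last first.
    by rewrite subnKC // ltnW.
  by case: d dE => [|[|d]]; rewrite ?mul0n ?mul1n ?mulSn; lia.
rewrite (eq_big_nat _ _ (F2 := fun k =>
  (if k == t then - ((l ^ m)%:R * c (t * l ^ m.-1 - i)%N) else 0) +
  (-1) ^+ t * ((l ^ m.-1)%:R * ((-1) ^+ k * c (k * l ^ m.-1 - i)%N)))).
  rewrite big_split /= -!mulr_sumr -big_mkcond /= big_nat1_eq t_gt0 t_lt /Delta.
  by rewrite /=; ring.
move=> k k_range; rewrite sign lkt //; case: eqP => [->|_] /=.
  (* At k = t the two signs (-1)^t cancel; they square to 1. *)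
  have : (-1) ^+ t * (-1) ^+ t = 1 :> 'F_p.
    by rewrite -exprD addnn -mul2n exprM sqrrN !expr1n.
  move: ((-1) ^+ t) => e ee.
  ring: ee.
ring.
Qed.

End Evaluation.

(** * The character sum *)

Theorem theorem2p4 (R : realType) (p l m : nat)
  (p_prime : prime p) (p_odd : odd p) (l_prime : prime l) (l_odd : odd l)
  (m_gt0 : (0 < m)%N) (p_prim : primitive_root_mod (2 * l ^ m) p)
  (q : nat) (q_def : q = (p ^ totient (2 * l ^ m))%N)
  (F : finFieldType) (cardF : #|F| = q)
  (g : {unit F}) (g_prim : generator [set: {unit F}] g)
  (xi : F) (xi_def : xi = FinRing.uval g ^+ ((q - 1) %/ (2 * l ^ m))%N)
  (a : F) (c : nat -> 'F_p)
  (a_def : a = \sum_(1 <= s < (totient (l ^ m)).+1) Fp_in F (c s) * xi ^+ s) :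
  let Delta (i : nat) : 'F_p :=
    - ((l ^ m.-1)%N%:R *
       \sum_(1 <= k < l) (-1) ^+ k * c (k * l ^ m.-1 - i)%N) in
  let delta (i t : nat) : R[i] :=
    zeta_pow R ((-1) ^+ t * Delta i
                + (l ^ m)%N%:R * c (t * l ^ m.-1 - i)%N) in
  char_sum R p xi (2 * l ^ m) a =
  \sum_(0 <= i < l ^ m.-1)
     (zeta_pow R (Delta i) + zeta_pow R (- Delta i)
      + \sum_(1 <= t < l) (delta i t + (delta i t)^-1)).
Proof.
move=> Delta delta.
have n_gt1 : (1 < l ^ m)%N by rewrite -(exp1n m) ltn_exp2r // prime_gt1.
have n_gt0 := ltnW n_gt1.
rewrite q_def in cardF.
have xi_prim : (2 * l ^ m).-primitive_root xi.
  have N_dvd : (2 * l ^ m %| #|F|.-1)%N.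
    rewrite cardF -subn1 -[X in (_ - X)%N](expn0 p).
    rewrite -eqn_mod_dvd ?leq_exp2l ?prime_gt1 //.
    by rewrite primitive_root_mod_eq ?modnn ?mod0n //; lia.
  rewrite xi_def q_def -cardF subn1.
  by rewrite (dvdn_prim_root (generator_prim_root g_prim)).
have tr_xi j : abs_tr p (a * xi ^+ j) =
    \sum_(1 <= s < (totient (l ^ m)).+1) c s * root_trace p l m (s + j).
  by rewrite a_def; apply: abs_tr_root_combination.
(* n = l^m is odd, and a multiple of both moduli, so adding n to the exponent
   only changes the sign. *)
have root_traceN k : root_trace p l m (l ^ m + k) = - root_trace p l m k.
  rewrite /root_trace dvdn_addr // dvdn_addr ?dvdn_exp2l ?leq_pred //.
  by rewrite exprD -[in (-1) ^+ (l ^ m)]signr_odd oddX l_odd orbT mulN1r mulNr.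
have tr_xiN j : abs_tr p (a * xi ^+ (l ^ m + j)) = - abs_tr p (a * xi ^+ j).
  rewrite !tr_xi -sumrN; apply: eq_bigr => s _.
  by rewrite addnCA root_traceN mulrN.
pose Z j := zeta_pow R (abs_tr p (a * xi ^+ j))
            + zeta_pow R (- abs_tr p (a * xi ^+ j)).
have -> : char_sum R p xi (2 * l ^ m) a = \sum_(0 <= j < l ^ m) Z j.
  rewrite /char_sum -(big_mkord xpredT (fun j => canon_char R p (a * xi ^+ j))).
  rewrite sum_nat_blocks big_ltn // big_nat1 -big_split /=.
  apply: eq_bigr => j _; rewrite !canon_charE.
  by rewrite mul0n mul1n add0n tr_xiN.
have -> : (l ^ m = l * l ^ m.-1)%N by rewrite -expnS prednK.
rewrite sum_nat_blocks exchange_big_nat; apply: eq_big_nat => i /andP[_ i_lt].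
rewrite big_ltn ?prime_gt0 // /Z mul0n add0n tr_xi trace_at_first //.
(* The reversal turns the block index r into l - t. *)
congr (_ + _); rewrite big_nat_rev; apply: eq_big_nat => t t_range /=.
have -> : (1 + l - t.+1 = l - t)%N by lia.
rewrite tr_xi trace_at_rest // opprK addrC /delta.
by rewrite -(zeta_powN R p_prime).
Qed.
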